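(* Let $A\in\mathbb{C}^{n\times n}$ and let $X$ be a minimal rank weak Drazin inverse of $A$. If $Y=A^{\dagger}XA$, then $Y$ is a strong Bott–Duffin $(A^{\dagger}XA^{2},\;AA^{\dagger}XA)$-inverse of $A$.
   Context: $A^{\dagger}$ is the Moore–Penrose inverse of $A$. The index $\operatorname{ind}(A)$ is the smallest nonnegative integer $k$ such that $\operatorname{rank}(A^k)=\operatorname{rank}(A^{k+1})$. $A^{D}$ is the Drazin inverse of $A$: the unique $T$ with $TAT=T$, $AT=TA$, $A^{k+1}T=A^k$ where $k=\operatorname{ind}(A)$. A matrix $X\in\mathbb{C}^{n\times n}$ is a minimal rank weak Drazin inverse of $A$ if $XA^{k+1}=A^{k}$ for some $k\in\mathbb{N}$ and $\operatorname{rank}(X)=\operatorname{rank}(A^{D})$. For a fixed such $X$, $A^{\dagger}XA$ is called the weak MPD inverse of $A$. Given a semigroup $S$ and idempotents $e,f\in S$, an element $y\in S$ is the strong Bott–Duffin $(e,f)$-inverse of $a\in S$ if $yay=y$, $ya=e$ and $ay=f$ (such $y$ is unique if it exists). Here $S=\mathbb{C}^{n\times n}$ under multiplication; the assertion includes that the two given matrices $e,f$ are idempotent. *)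

(* Defs.v *)
From mathcomp Require Import all_boot all_order all_algebra.
From mathcomp Require Import complex reals.

Set Implicit Arguments.
Unset Strict Implicit.
Unset Printing Implicit Defensive.

Import Order.TTheory GRing.Theory Num.Theory.
Local Open Scope ring_scope.
Local Open Scope sesquilinear_scope.

Section MoorePenrose.
Variable C : numClosedFieldType.

(* The four Penrose equations, as a boolean predicate so that [xchoose]
   applies. *)
Definition is_moore_penrose m n (A : 'M[C]_(m, n)) : pred 'M[C]_(n, m) :=
  fun M => [&& A *m M *m A == A, M *m A *m M == M,
               (A *m M) ^t* == A *m M & (M *m A) ^t* == M *m A].

Lemma adjmxM m n p (A : 'M[C]_(m, n)) (B : 'M[C]_(n, p)) :
  (A *m B) ^t* = B ^t* *m A ^t*.
Proof. by rewrite trmx_mul map_mxM. Qed.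

Lemma adjmxK m n (A : 'M[C]_(m, n)) : A ^t* ^t* = A.
Proof. by apply/matrixP => i j; rewrite !mxE conjCK. Qed.

Lemma mulmx_adj_eq0 m n (A : 'M[C]_(m, n)) : A *m A ^t* = 0 -> A = 0.
Proof.
move=> AA0; apply/matrixP => i j; rewrite mxE.
have /eqP := congr1 (fun M : 'M_m => M i i) AA0.
rewrite !mxE psumr_eq0 => [/allP/(_ j (mem_index_enum j))|k _].
  by rewrite !mxE -normCK expf_eq0 normr_eq0 => /eqP.
by rewrite !mxE -normCK exprn_ge0.
Qed.

Lemma row_free_gram m n (A : 'M[C]_(m, n)) :
  row_free A -> A *m A ^t* \in unitmx.
Proof.
move=> Afree; rewrite -row_free_unit -kermx_eq0; apply/eqP.
set K := kermx _; apply: (row_free_inj Afree); rewrite mul0mx.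
apply: mulmx_adj_eq0.
by rewrite adjmxM mulmxA -(mulmxA K) mulmx_ker mul0mx.
Qed.

Lemma moore_penrose_exists m n (A : 'M[C]_(m, n)) :
  exists M, is_moore_penrose A M.
Proof.
have [r [F [G [AE Ffull Gfree]]]] : exists r (F : 'M_(m, r)) (G : 'M_(r, n)),
    [/\ A = F *m G, row_full F & row_free G].
  exists (\rank A), (col_base A), (row_base A).
  by rewrite mulmx_base; split=> //; [exact: col_base_full | exact: row_base_free].
have GU : G *m G ^t* \in unitmx by exact: row_free_gram.
have FU : F ^t* *m F \in unitmx.
  rewrite -[X in _ *m X]adjmxK; apply/row_free_gram.
  by rewrite /row_free mxrank_map mxrank_tr.
pose P := invmx (F ^t* *m F); pose Q := invmx (G *m G ^t*).
have PH : P ^t* = P.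
  by rewrite /P trmx_inv map_invmx adjmxM adjmxK.
have QH : Q ^t* = Q.
  by rewrite /Q trmx_inv map_invmx adjmxM adjmxK.
pose M := G ^t* *m Q *m P *m F ^t*.
have GK p (B : 'M_(_, p)) : G *m (G ^t* *m (Q *m B)) = B.
  by rewrite 2!mulmxA mulmxV ?mul1mx.
have FK p (B : 'M_(_, p)) : P *m (F ^t* *m (F *m B)) = B.
  by rewrite (mulmxA (F ^t*)) mulmxA mulVmx ?mul1mx.
have AM : A *m M = F *m (P *m F ^t*) by rewrite AE /M -!mulmxA GK.
have MA : M *m A = G ^t* *m (Q *m G) by rewrite AE /M -!mulmxA FK.
exists M; apply/and4P; split; apply/eqP.
- by rewrite AM AE -!mulmxA FK.
- by rewrite MA /M -!mulmxA GK.
- by rewrite AM !adjmxM adjmxK PH mulmxA.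
- by rewrite MA !adjmxM adjmxK QH mulmxA.
Qed.

Definition moore_penrose m n (A : 'M[C]_(m, n)) : 'M[C]_(n, m) :=
  xchoose (moore_penrose_exists A).

Lemma moore_penroseP m n (A : 'M[C]_(m, n)) :
  is_moore_penrose A (moore_penrose A).
Proof. exact: xchooseP. Qed.

Lemma moore_penrose_uniq m n (A : 'M[C]_(m, n)) M :
  is_moore_penrose A M -> M = moore_penrose A.
Proof.
move: (moore_penrose A) (moore_penroseP A) => N.
case/and4P=> /eqP n1 /eqP n2 /eqP n3 /eqP n4.
case/and4P=> /eqP m1 /eqP m2 /eqP m3 /eqP m4.
have AE : A *m M = A *m N.
  by rewrite -m3 -n3 -{1}n1 -(mulmxA (A *m N)) adjmxM m3 n3 mulmxA m1.
have EA : M *m A = N *m A.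
  by rewrite -m4 -n4 -{1}n1 -(mulmxA A) mulmxA adjmxM m4 n4 -mulmxA
             (mulmxA A) m1.
by rewrite -m2 EA -mulmxA AE mulmxA n2.
Qed.

End MoorePenrose.

Section Drazin.
Variable F : fieldType.
Variable n : nat.
Implicit Types A X T : 'M[F]_n.

Lemma index_exists A : exists k, \rank (A ^+ k) == \rank (A ^+ k.+1).
Proof.
have [k /eqP kE|noidx] := pickP (fun k : 'I_n.+1 =>
    \rank (A ^+ k) == \rank (A ^+ k.+1)); first by exists k; apply/eqP.
suff H k : (k <= n.+1)%N -> (\rank (A ^+ k) + k <= n)%N.
  by have := H _ (leqnn _); rewrite addnS ltnNge leq_addl.
elim: k => [_|k IHk kn]; first by rewrite addn0 rank_leq_row.
apply: leq_trans (IHk (ltnW kn)); rewrite addnS ltn_add2r.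
have := noidx (Ordinal kn); rewrite /= eq_sym => /negbT neq.
by rewrite ltn_neqAle neq exprS mxrankM_maxr.
Qed.

Definition index A : nat := ex_minn (index_exists A).

Definition is_drazin A : pred 'M[F]_n :=
  fun T => [&& T * A * T == T, A * T == T * A &
               A ^+ (index A).+1 * T == A ^+ index A].

Lemma drazin_exists A : exists T, is_drazin A T.
Proof.
rewrite /is_drazin /index; case: ex_minnP => k /eqP rk _.
have [Z ZE] : exists Z, A ^+ k = Z * A ^+ k.+1.
  apply/submxP; have := mxrank_leqif_sup (submxMl A (A ^+ k)).
  by rewrite -[A *m _]/(A * A ^+ k) -exprS rk => -[_ <-].
have [W WE] : exists W, A ^+ k = A ^+ k.+1 * W.
  have sub : ((A ^+ k.+1)^T <= (A ^+ k)^T)%MS.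
    by rewrite exprSr [_ * _]/(_ *m _) trmx_mul submxMl.
  have := mxrank_leqif_sup sub; rewrite !mxrank_tr rk => -[_ /esym].
  rewrite eqxx => /submxP[D DE]; exists D^T; apply: trmx_inj.
  by rewrite DE [_ * D^T]/(_ *m _) trmx_mul trmxK.
have ZjE j : Z ^+ j * A ^+ (k + j) = A ^+ k.
  elim: j => [|j IHj]; first by rewrite mul1r addn0.
  by rewrite exprSr addnS -addSn exprD -mulrA (mulrA Z) -ZE -exprD.
have WjE j : A ^+ (k + j) * W ^+ j = A ^+ k.
  elim: j => [|j IHj]; first by rewrite mulr1 addn0.
  by rewrite exprS addnS -addSn addnC exprD -mulrA (mulrA _ W) -WE
             mulrA -exprD addnC.
pose T := A ^+ k * W ^+ k.+1.
have TE : T = Z ^+ k.+1 * A ^+ k.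
  by rewrite /T -[in LHS](ZjE k.+1) -mulrA WjE.
have AT : A * T = T * A.
  have -> : T * A = Z ^+ k.+1 * (A * A ^+ k) by rewrite TE -mulrA -exprSr -exprS.
  rewrite -[in RHS](WjE k.+1) (mulrA A) -exprS [A ^+ (k + _).+1]exprSr.
  by rewrite !mulrA ZjE -exprSr -exprS.
have AkT : A ^+ k.+1 * T = A ^+ k.
  by rewrite mulrA -exprD addnC WjE.
exists T; apply/and3P; split; apply/eqP => //.
by rewrite {1}TE -(mulrA _ (A ^+ k)) -exprSr -mulrA AkT -TE.
Qed.

Definition drazin A : 'M[F]_n := xchoose (drazin_exists A).

Lemma drazinP A : is_drazin A (drazin A).
Proof. exact: xchooseP. Qed.

Lemma drazin_uniq A T : is_drazin A T -> T = drazin A.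
Proof.
move: (drazin A) (drazinP A) => S.
case/and3P=> /eqP SAS /eqP AS /eqP AkS /and3P[/eqP TAT /eqP AT /eqP AkT].
have powE U j : U * A * U = U -> A * U = U * A ->
    U * A = U ^+ j.+1 * A ^+ j.+1.
  move=> UAU AU; rewrite -exprMn_comm; last exact/esym.
  by elim: j => // j IHj; rewrite exprS -IHj mulrA UAU.
have TS : T * A = T * A * (S * A).
  by rewrite (powE T (index A)) // -mulrA (mulrA _ S) AkS -exprSr.
have ST : S * A = T * A * (S * A).
  have comm U : A * U = U * A -> GRing.comm U (A ^+ (index A).+1).
    by move=> AU; apply/commrX; rewrite /GRing.comm AU.
  rewrite (powE S (index A)) //.
  have -> : S ^+ (index A).+1 * A ^+ (index A).+1
            = A ^+ (index A).+1 * S ^+ (index A).+1.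
    by apply/commr_sym/commrX/commr_sym/comm.
  by rewrite mulrA -AT -(mulrA A) (comm T) // AkT -exprS.
have E : T * A = S * A by rewrite ST.
by rewrite -TAT E -mulrA AT E -AS mulrA.
Qed.

End Drazin.

Definition min_rank_weak_drazin (F : fieldType) n (A X : 'M[F]_n) : Prop :=
  (exists k : nat, X * A ^+ k.+1 = A ^+ k) /\ \rank X = \rank (drazin A).

Definition weak_mpd (C : numClosedFieldType) n (A X : 'M[C]_n) : 'M[C]_n :=
  moore_penrose A * X * A.

(* The notion presupposes idempotents e and f, hence the first two fields. *)
Record strong_bott_duffin (S : Type) (op : SemiGroup.law S) (e f a y : S) :
    Prop := StrongBottDuffin {
  sbd_idem_l : op e e = e;
  sbd_idem_r : op f f = f;
  sbd_outer : op (op y a) y = y;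
  sbd_left : op y a = e;
  sbd_right : op a y = f
}.

(* Main.v *)
(* The minimal rank condition forces the columns of [X] to span the same space
    as those of [A ^+ k.+1], so [X = A ^+ k.+1 * W] for some [W]. This gives
    [X * A * X = X] and, writing [M] for the Moore-Penrose inverse of [A],
    [A * M * X = X]; the five identities follow by associativity. *)
Require Import Defs.
From mathcomp Require Import all_boot all_order all_algebra.
From mathcomp Require Import complex reals.

Import GRing.Theory.
Local Open Scope ring_scope.

(** With [D] the Drazin inverse, commutation turns [D A D = D] into [D = A D^2], which iterates to
    [D = A^j D^(j+1)]. *)
Lemma mxrank_drazin_le_exp (F : fieldType) (n : nat) (A : 'M[F]_n) (j : nat) :
  (\rank (drazin A) <= \rank (A ^+ j))%N.
Proof.
case/and3P: (drazinP A) => /eqP DAD /eqP AD _.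
have -> : drazin A = A ^+ j * drazin A ^+ j.+1.
  elim: j => [|j IHj]; first by rewrite mul1r.
  by rewrite exprS [in RHS]exprSr mulrA -(mulrA A) -IHj AD DAD.
exact: mxrankM_maxl.
Qed.

(** One inclusion of column spaces plus the rank bound gives equality; [<=] compares row spaces,
    hence the transposes. *)
Lemma weak_drazin_factor (F : fieldType) (n : nat) (A X : 'M[F]_n) (k : nat) :
    X * A ^+ k.+1 = A ^+ k -> \rank X = \rank (drazin A) ->
  exists W, X = A ^+ k * W.
Proof.
move=> XA rX.
have sAX : ((A ^+ k)^T <= X^T)%MS.
  by rewrite -XA [_ * _]/(_ *m _) trmx_mul submxMl.
have : (X^T <= (A ^+ k)^T)%MS.
  rewrite -(mxrank_leqif_sup sAX) eqn_leq mxrankS //= !mxrank_tr rX.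
  exact: mxrank_drazin_le_exp.
case/submxP=> D DE; exists D^T; apply: trmx_inj.
by rewrite DE [_ * D^T]/(_ *m _) trmx_mul trmxK.
Qed.

Lemma min_rank_weak_drazin_factor (F : fieldType) (n : nat) (A X : 'M[F]_n) :
  min_rank_weak_drazin A X -> X * A * X = X /\ exists V, X = A * V.
Proof.
case=> -[k XA] rX.
(* The raised exponent leaves a left factor [A] to split off even when [k = 0]. *)
have XA1 : X * A ^+ k.+2 = A ^+ k.+1 by rewrite exprSr mulrA XA -exprSr.
have [W XE] := weak_drazin_factor _ _ _ _ _ XA1 rX.
split; last by exists (A ^+ k * W); rewrite mulrA -exprS.
by rewrite {2}XE mulrA -(mulrA X) -exprS XA1.
Qed.

Theorem proposition3p14 (R : realType) (n : nat) (A X Y : 'M[R[i]]_n)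
    (hX : min_rank_weak_drazin A X) (hY : Y = weak_mpd A X) :
  strong_bott_duffin *%R
    (moore_penrose A * X * A ^+ 2) (A * moore_penrose A * X * A) A Y.
Proof.
have [XAX [V XE]] := min_rank_weak_drazin_factor _ _ _ _ hX.
have /and4P[/eqP AMA _ _ _] := moore_penroseP A.
have AMX : A * moore_penrose A * X = X by rewrite XE mulrA [_ * A]AMA.
rewrite hY /weak_mpd AMX; move: (moore_penrose A) AMX => M AMX.
(* Serves both the idempotence of [M X A^2] and the outer identity. *)
have MXAAMX : M * X * A * A * M * X = M * X.
  by rewrite -!mulrA (mulrA A M) AMX (mulrA X A) XAX.
by split; rewrite /= ?expr2 ?mulrA ?AMX ?MXAAMX ?XAX.
Qed.
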